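(* Let $k\geq 3$ be an integer. There exists an explicit sequence of $k$-tensors $t_n\in(\mathbb{C}^{2^n})^{\otimes k}$, $n\ge 1$, such that \[ \frac{\mathrm{R}(t_n)}{\underline{\mathrm{R}}(t_n)}\;\geq\; k-o(1)\qquad\text{as } n\to\infty . \] Namely, let $t_n = W_k^{\otimes n}\in(\mathbb{C}^{2^n})^{\otimes k}$ be the $n$-fold tensor Kronecker product of $W_k$. Then $\underline{\mathrm{R}}(t_n)=2^n$ for every $n$, and $\mathrm{R}(t_n)\geq k\cdot 2^n-o(2^n)$ as $n\to\infty$ (with $k$ fixed).
   Context: Let $V_1,\ldots,V_k$ be finite-dimensional complex vector spaces. A tensor in $V_1\otimes\cdots\otimes V_k$ of the form $v_1\otimes\cdots\otimes v_k$ is called simple. The tensor rank $\mathrm{R}(t)$ of $t\in V_1\otimes\cdots\otimes V_k$ is the smallest number $r$ such that $t$ is a sum of $r$ simple tensors. The border rank $\underline{\mathrm{R}}(t)$ is the smallest number $r$ such that $t$ is the limit, in the Euclidean topology, of a sequence of tensors in $V_1\otimes\cdots\otimes V_k$ of rank at most $r$. Let $e_0,e_1$ be the standard basis of $\mathbb{C}^2$. The generalised W-state tensor is \[ W_k = e_1\otimes e_0\otimes\cdots\otimes e_0+e_0\otimes e_1\otimes\cdots\otimes e_0+\cdots+e_0\otimes\cdots\otimes e_0\otimes e_1\in(\mathbb{C}^2)^{\otimes k}. \] The tensor Kronecker product of $k$-tensors $s\in U_1\otimes\cdots\otimes U_k$ and $t\in V_1\otimes\cdots\otimes V_k$ is $s\otimes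 t$ regarded as a $k$-tensor in $(U_1\otimes V_1)\otimes\cdots\otimes(U_k\otimes V_k)$. Thus $W_k^{\otimes n}$ is regarded as a $k$-tensor in $(\mathbb{C}^{2^n})^{\otimes k}$, where each factor $\mathbb{C}^{2^n}$ is identified with $(\mathbb{C}^2)^{\otimes n}$, and rank and border rank are taken with respect to this $k$-tensor structure. *)

(* Defs.v *)
From HB Require Import structures.
From mathcomp Require Import all_boot all_order all_algebra.
From mathcomp Require Import complex mxtens.
From mathcomp Require Import boolp classical_sets reals topology normedtype.
From mathcomp Require Import sequences landau.
Set Implicit Arguments.
Unset Strict Implicit.
Unset Printing Implicit Defensive.
Import Order.TTheory GRing.Theory Num.Theory.
Import numFieldNormedType.Exports.
Local Open Scope classical_set_scope.
Local Open Scope ring_scope.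
Local Open Scope complex_scope.

(* A [k]-tensor in (C^d)^{(x) k}, C = R[i], is given by its coordinates in the
   product of the standard bases. *)
Definition tensor (R : realType) (k d : nat) :=
  {ffun {ffun 'I_k -> 'I_d} -> R[i]}.

Section Rank.
Variables (R : realType) (k d : nat).
Implicit Types (t : tensor R k d) (r : nat).

Definition simple_tensor (v : 'I_k -> 'rV[R[i]]_d) : tensor R k d :=
  [ffun f : {ffun 'I_k -> 'I_d} => \prod_(j < k) v j ord0 (f j)].

Definition sum_of_simple t r : Prop :=
  exists v : 'I_r -> 'I_k -> 'rV[R[i]]_d, t = \sum_(i < r) simple_tensor (v i).

(* The least element of [P], and the junk value 0 if [P] is empty. *)
Definition least (P : set nat) : nat :=
  xget 0%N [set r | P r /\ forall s, P s -> (r <= s)%N].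

Definition tensor_rank t : nat := least [set r | sum_of_simple t r].

(* The Euclidean distance of C^(d^k), as an element of [R]: [R[i]] carries no
   canonical topology, and [`|z|] for [z : R[i]] lives in [R[i]]. *)
Definition tensor_dist (s t : tensor R k d) : R :=
  Num.sqrt (\sum_f ComplexField.Normc.normc (s f - t f) ^+ 2).

Definition limit_of_rank_le t r : Prop :=
  exists u : nat -> tensor R k d,
    (forall m, (tensor_rank (u m) <= r)%N) /\
    tensor_dist (u m) t @[m --> \oo] --> (0 : R).

Definition border_rank t : nat := least [set r | limit_of_rank_le t r].

End Rank.

Section Kronecker.
Variables (R : realType) (k : nat).

(* [mxtens_unindex : 'I_(m * n) -> 'I_m * 'I_n] identifies the standard basis
   of C^(m n) with the product basis of C^m (x) C^n. *)
Definition kron m n (s : tensor R k m) (t : tensor R k n) :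
    tensor R k (m * n) :=
  [ffun f : {ffun 'I_k -> 'I_(m * n)} =>
     s [ffun j => (mxtens_unindex (f j)).1] *
     t [ffun j => (mxtens_unindex (f j)).2]].

(* This typechecks without casts because [d ^ 1] and [d ^ n.+2] are
   convertible to [d] and [d * d ^ n.+1]. *)
Fixpoint kron_pow d (t : tensor R k d) (n : nat) : tensor R k (d ^ n) :=
  match n with
  | 0 => [ffun=> 1]
  | n1.+1 =>
    match n1 return tensor R k (d ^ n1) -> tensor R k (d ^ n1.+1) with
    | 0 => fun=> t
    | n2.+1 => fun u => kron t u
    end (kron_pow t n1)
  end.

Definition W : tensor R k 2 :=
  \sum_(i < k) simple_tensor
    (fun j => if j == i then delta_mx ord0 1 else delta_mx ord0 0).

End Kronecker.

Lemma kron_powSS (R : realType) k d (t : tensor R k d) n :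
  kron_pow t n.+2 = kron t (kron_pow t n.+1).
Proof. by []. Qed.

Lemma leastP (P : set nat) : (exists r, P r) ->
  P (least P) /\ forall s, P s -> (least P <= s)%N.
Proof.
move=> [r0 Pr0]; rewrite /least.
have h : exists r, `[< P r >] by exists r0; apply/asboolP.
case: (ex_minnP h) => r /asboolP Pr rmin.
by case: xgetP => [x _ //|/(_ r)] /=; case; split=> // s Ps; apply/rmin/asboolP.
Qed.

(* [0 < k] is needed because for [k = 0] the only simple tensor is the scalar 1. *)
Section RankSpec.
Variables (R : realType) (k d : nat).
Implicit Types t : tensor R k d.

Lemma sum_of_simple_ex (k_gt0 : (0 < k)%N) t : exists r, sum_of_simple t r.
Proof.
pose I := {ffun 'I_k -> 'I_d}.
exists #|I|; pose g (i : 'I_#|I|) : I := enum_val i.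
exists (fun i j => (if j == Ordinal k_gt0 then t (g i) else 1) *:
                   delta_mx ord0 (g i j)).
apply/ffunP => f; rewrite sum_ffunE.
rewrite (bigD1 (enum_rank f)) //= [X in _ + X]big1 ?addr0 => [|i ne].
  rewrite !ffunE /g enum_rankK (bigD1 (Ordinal k_gt0)) //= big1 => [|j /negPf ->].
    by rewrite !mxE !eqxx !mulr1.
  by rewrite !mxE !eqxx !mulr1.
rewrite !ffunE; have [e|/forallPn[j fj]] := boolP [forall j, g i j == f j].
  case/eqP: ne; rewrite -(enum_valK i); congr enum_rank.
  by apply/ffunP => j; apply/eqP/(forallP e).
by rewrite (bigD1 j) //= !mxE eqxx [f j == _]eq_sym (negPf fj) mulr0 mul0r.
Qed.

Lemma tensor_rankP (k_gt0 : (0 < k)%N) t : sum_of_simple t (tensor_rank t) /\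
  forall s, sum_of_simple t s -> (tensor_rank t <= s)%N.
Proof. exact/leastP/(sum_of_simple_ex k_gt0). Qed.

Lemma tensor_distxx t : tensor_dist t t = 0.
Proof.
rewrite /tensor_dist big1 ?sqrtr0 // => f _.
by rewrite subrr ComplexField.Normc.normc0 expr0n.
Qed.

Lemma border_rankP t : limit_of_rank_le t (border_rank t) /\
  forall s, limit_of_rank_le t s -> (border_rank t <= s)%N.
Proof.
apply: leastP; exists (tensor_rank t); exists (fun=> t); split=> //.
by rewrite tensor_distxx; apply: cvg_cst.
Qed.

End RankSpec.

(* Main.v *)
(* Up to a relabelling of the basis by subsets of [n], the entry of W_k^{(x) n}
   at (S_1, ..., S_k) is 1 if every x in [n] lies in exactly one S_j, and 0
   otherwise; so T(a_1, ..., a_k) is the coefficient of x_1 ... x_n in the product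
   a_1 ... a_k of the algebra C[x_1, ..., x_n] / (x_1^2, ..., x_n^2).

   Rank. Take a decomposition of T into r simple tensors and d = n/3 + O(1), and
   let M be the span of the monomials of degree at least d. For each mode j in
   turn, the forms of mode j that belong to the remaining terms separate M: if
   they all vanished at some nonzero v in M with leading monomial x_V, one could
   choose in two other modes elements with leading monomials x_P and x_Q, where
   P and Q split the complement of V and have fewer than d elements, and elements
   with leading monomial 1 in the remaining modes. Modulo M these may be
   prescribed, so in the modes already treated they can be chosen to kill the
   discarded terms. Then T would be 0 there, but it equals the leading coefficient of v.
   Hence each mode allows one to discard dim M terms, and r >= k dim M. By
   Chebyshev's inequality dim M = 2^n - O(2^n / n).

   Border rank. W_k is the limit of ((e_0 + e e_1)^{(x) k} - e_0^{(x) k}) / e, so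
   the border rank is at most 2^n. Conversely, flattening along two modes, with
   the empty set in the others, gives the permutation matrix of complementation,
   and every matrix close enough to it is still invertible. *)
Require Import Defs.
From HB Require Import structures.
From mathcomp Require Import all_boot all_order all_algebra.
From mathcomp Require Import complex mxtens.
From mathcomp Require Import boolp classical_sets reals topology normedtype.
From mathcomp Require Import sequences landau.
From mathcomp Require Import zify.
Set Implicit Arguments.
Unset Strict Implicit.
Unset Printing Implicit Defensive.
Import Order.TTheory GRing.Theory Num.Theory.
Import numFieldNormedType.Exports.
Local Open Scope ring_scope.

(** * Coordinates of the Kronecker powers of [W] as ordered set partitions *)

(** [b] lists the base-[d] digits of an index. The induction starts at 1, since [kron_pow t 1] is
    [t] itself. *)
Lemma kron_pow_coords (R : realType) (k d n : nat) : (1 <= n)%N ->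
  exists2 b : 'I_(d ^ n) -> {ffun 'I_n -> 'I_d}, injective b &
    forall (t : tensor R k d) f,
      kron_pow t n f = \prod_(x < n) t [ffun j => b (f j) x].
Proof.
case: n => // n _; elim: n => [|n [b b_inj tb]].
  exists (fun i => [ffun=> i]) => [i j /ffunP/(_ ord0)|t f]; first by rewrite !ffunE.
  rewrite big_ord1 -/(kron_pow t 1) /=; congr (fun_of_fin t _).
  by apply/ffunP => j; rewrite !ffunE.
exists (fun i => [ffun x => if unlift ord0 x is Some y
                            then b (mxtens_unindex i).2 y
                            else (mxtens_unindex i).1]).
  move=> i j /ffunP eq_ij; apply: (can_inj (@mxtens_unindexK _ _)).
  have := eq_ij ord0; rewrite !ffunE unlift_none.
  have : b (mxtens_unindex i).2 = b (mxtens_unindex j).2.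
    by apply/ffunP => y; have := eq_ij (lift ord0 y); rewrite !ffunE liftK.
  by move=> /b_inj; case: mxtens_unindex => ? ?; case: mxtens_unindex => ? ? /= -> ->.
move=> t f; rewrite kron_powSS ffunE tb [RHS]big_ord_recl; congr (_ * _).
  by congr (fun_of_fin t _); apply/ffunP => j; rewrite !ffunE unlift_none.
apply: eq_bigr => x _; congr (fun_of_fin t _).
by apply/ffunP => j; rewrite !ffunE liftK.
Qed.

(** These are the ordered partitions of [n] into k parts, empty parts allowed. *)
Definition covers_once (n k : nat) (f : {ffun 'I_k -> {set 'I_n}}) : bool :=
  [forall x, (\sum_j (x \in f j) == 1)%N].

Lemma W_coordE (R : realType) (k : nat) (g : {ffun 'I_k -> 'I_2}) :
  W R k g = (\sum_j (g j == 1 :> 'I_2)%R == 1)%N%:R.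
Proof.
rewrite /W sum_ffunE.
rewrite (eq_bigr (fun i => [forall j, (g j == 1) == (j == i)]%:R)) => [|i _]; last first.
  rewrite /simple_tensor ffunE.
  have [/forallP h|/forallPn[j hj]] := boolP [forall j, (g j == 1) == (j == i)].
    rewrite big1// => j _; move: (h j); case: (j == i); rewrite !mxE /=;
      by case: (g j) => [[|[|m]] p] //=.
  apply/eqP; rewrite (bigD1 j) //= mulf_eq0; apply/orP; left; move: hj.
  by case: (j == i); rewrite !mxE /=; case: (g j) => [[|[|m]] p] //=.
have [/sum_nat_eq1[i [_ gi gj]]|ne1] := boolP (_ == 1)%N.
  have gE j : (g j == 1 :> 'I_2) = (j == i).
    by case: (eqVneq j i) => [->|/gj/(_ isT)]; [move: gi|]; case: (_ == 1).
  rewrite (bigD1 i) //= big1 ?addr0.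
    by rewrite (_ : [forall j, _]) //; apply/forallP => j; rewrite gE.
  move=> j ji; have [/forallP/(_ j)|//] := boolP [forall j0, (g j0 == 1) == (j0 == j)].
  by rewrite gE eqxx (negPf ji).
rewrite big1 // => i _; have [/forallP gE|//] := boolP [forall j, (g j == 1) == (j == i)].
case/negP: ne1; rewrite (bigD1 i) //= (eqP (gE i)) eqxx big1 // => j /negPf ji.
by rewrite (eqP (gE j)) ji.
Qed.

Lemma W_pow_sets (R : realType) (k n : nat) : (1 <= n)%N ->
  exists2 b : 'I_(2 ^ n) -> {set 'I_n}, bijective b &
    forall f, kron_pow (W R k) n f = (covers_once [ffun j => b (f j)])%:R.
Proof.
move=> n1; have [b b_inj tb] := @kron_pow_coords R k 2 n n1.
exists (fun i => [set x | b i x == 1]).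
  apply: inj_card_bij.
    move=> i j /setP eq_ij; apply/b_inj/ffunP => x; have := eq_ij x.
    by rewrite !inE; case: (b i x) => [[|[|m]] p] //=; case: (b j x) => [[|[|m']] p'] //= _;
      apply: val_inj.
  by rewrite -cardsT -powersetT card_powerset cardsT !card_ord.
move=> f; rewrite tb.
have sumE x : (\sum_j ([ffun j => b (f j) x] j == 1%R) =
    \sum_j (x \in [ffun j => [set x | b (f j) x == 1%R]] j))%N.
  by apply: eq_bigr => j _; rewrite !ffunE inE.
have [/forallP h|/forallPn[x hx]] := boolP (covers_once _).
  by rewrite big1 // => x _; rewrite W_coordE sumE (h x).
by rewrite (bigD1 x) //= W_coordE sumE (negPf hx) mul0r.
Qed.

(** * Rank lower bound by substitution *)

(** The substitution method. Forms that separate the vectors supported on [B] have full rank there,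
    so #|B| of them restrict to a basis of the dual. Solving an invertible system in the coordinates
    in [B] kills these, whatever the other coordinates are. *)
Lemma substitution (F : fieldType) (X I : finType) (u : I -> X -> F)
    (S : {set I}) (B : {set X}) :
  (forall v : X -> F, (forall x, x \notin B -> v x = 0) ->
     (forall i, i \in S -> \sum_x u i x * v x = 0) -> forall x, v x = 0) ->
  exists J : {set I}, [/\ J \subset S, #|J| = #|B| &
    forall a : X -> F, exists2 a' : X -> F, (forall x, x \notin B -> a' x = a x) &
      forall i, i \in J -> \sum_x u i x * a' x = 0].
Proof.
move=> sepB.
pose U := \matrix_(i < #|S|, x < #|B|) u (enum_val i) (enum_val x).
pose ext (w : 'I_#|B| -> F) (a : X -> F) x :=
  if [pick y | enum_val y == x] is Some y then w y else a x.
have extE w a y : ext w a (enum_val y) = w y.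
  by rewrite /ext; case: pickP => [z /eqP/enum_val_inj->//|/(_ y)]; rewrite eqxx.
have extN w a x : x \notin B -> ext w a x = a x.
  by rewrite /ext; case: pickP => // z /eqP <-; rewrite enum_valP.
have sumE w a i : \sum_x u i x * ext w a x =
    \sum_(y < #|B|) u i (enum_val y) * w y + \sum_(x | x \notin B) u i x * a x.
  rewrite (bigID (mem B)) /=; congr (_ + _).
    rewrite (@big_enum_val _ _ _ _ _ (fun x => u i x * ext w a x)).
    by apply: eq_bigr => y _; rewrite extE.
  by apply: eq_bigr => x /extN ->.
have fullU : row_full U.
  (* A kernel row, extended by 0 outside [B], is killed by all forms of [S], so [sepB] applies. *)
  rewrite /row_full -mxrank_tr -/(row_free _) -kermx_eq0; apply/eqP/row_matrixP => p.
  rewrite row0; set w := row p _.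
  have wU : w *m U^T = 0 by rewrite /w -row_mul mulmx_ker row0.
  clearbody w.
  have w0 := sepB (ext (w ord0) (fun=> 0)) (extN _ _) _.
  apply/rowP => y; rewrite [RHS]mxE -(extE (w ord0) (fun=> 0)).
  apply: w0 => i iS.
  rewrite sumE [X in _ + X]big1 ?addr0 => [|x _]; last by rewrite mulr0.
  have := congr1 (fun A : 'rV_ _ => A ord0 (enum_rank_in iS i)) wU.
  rewrite [RHS]mxE => wUi; rewrite -[RHS]wUi mxE; apply: eq_bigr => z _.
  by rewrite !mxE enum_rankK_in // mulrC.
pose U' := rowsub (fullrankfun fullU) U.
exists [set enum_val (fullrankfun fullU z) | z : 'I_#|B|]; split.
- by apply/fintype.subsetP => _ /imsetP[z _ ->]; apply: enum_valP.
- rewrite card_imset ?card_ord // => y z /enum_val_inj; exact: fullrankfun_inj.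
(* [c] moves the contribution of the coordinates outside [B] to the right-hand side. *)
move=> a; pose c := \col_z (- \sum_(x | x \notin B) u (enum_val (fullrankfun fullU z)) x * a x).
exists (ext (fun y => (invmx U' *m c) y ord0) a); first exact: extN.
move=> _ /imsetP[z _ ->]; rewrite sumE.
have := congr1 (fun A : 'cV_ _ => A z ord0) (mulKVmx (fullrowsub_unit fullU) c).
rewrite [RHS]mxE => /eqP; rewrite -addr_eq0 => /eqP h; rewrite -[RHS]h; congr (_ + _).
by rewrite mxE; apply: eq_bigr => y _; rewrite !mxE.
Qed.

Section CoversOnce.
Variables (n k : nat).
Implicit Types f s : {ffun 'I_k -> {set 'I_n}}.

Lemma covers_once_card s : covers_once s -> (\sum_j #|s j| = n)%N.
Proof.
move=> /forallP sP; rewrite -[RHS]card_ord -sum1_card.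
under eq_bigr => j _ do rewrite -sum1_card big_mkcond.
rewrite exchange_big; apply: eq_bigr => x _; rewrite -[RHS](eqP (sP x)).
by apply: eq_bigr => j _; case: ifP.
Qed.

(** Part [m] is the complement of the union of the others. *)
Lemma covers_once_inj s f m : covers_once s -> covers_once f ->
  (forall j, j != m -> f j = s j) -> f = s.
Proof.
move=> /forallP sP /forallP fP fs; apply/ffunP => j.
have [->|/fs//] := eqVneq j m; apply/setP => x.
have := eqP (sP x); rewrite -(eqP (fP x)) (bigD1 m) //= [RHS](bigD1 m) //=.
rewrite (eq_bigr (fun j => (x \in f j) : nat)) => [/addIn|i im]; last by rewrite fs.
by do 2 case: (x \in _).
Qed.

(** A nonzero term at [f] has #|s j| <= #|f j| for all [j]; both families of cardinalities sum to n,
    so they agree. Hence [f] equals [s] outside [m], and then at [m] too, even if mode [m] has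
    several monomials of least degree. *)
Lemma covers_once_leading (F : comRingType) (a : 'I_k -> {set 'I_n} -> F) s m :
  covers_once s ->
  (forall j, j != m -> a j (s j) = 1) ->
  (forall j Y, j != m -> a j Y != 0 -> Y = s j \/ (#|s j| < #|Y|)%N) ->
  (forall Y, a m Y != 0 -> (#|s m| <= #|Y|)%N) ->
  \sum_f (covers_once f)%:R * \prod_j a j (f j) = a m (s m).
Proof.
move=> sP a1 alt ale; rewrite (bigD1 s) //= sP mul1r [X in _ + X]big1 => [|f fs].
  by rewrite addr0 (bigD1 m) //= big1 ?mulr1 // => j /a1.
have [fP|] := boolP (covers_once f); last by rewrite mul0r.
have [j0 /eqP aj0|a_neq0] := pickP (fun j => a j (f j) == 0).
  by rewrite (bigD1 j0) //= aj0 mul0r mulr0.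
have sf j : (#|s j| <= #|f j|)%N.
  have [->|jm] := eqVneq j m; first by apply: ale; rewrite a_neq0.
  by case: (alt j (f j) jm (negbT (a_neq0 j))) => [->|/ltnW].
have card_eq j : #|s j| = #|f j|.
  apply/eqP; apply: contra_eqT (covers_once_card fP) => ne.
  rewrite -[X in _ != X](covers_once_card sP) neq_ltn; apply/orP; right.
  by rewrite (bigD1 j) //= [ltnRHS](bigD1 j) //= -addSn leq_add ?leq_sum // ltn_neqAle ne sf.
case/eqP: fs; apply: (@covers_once_inj s f m) => // j jm.
by case: (alt j (f j) jm (negbT (a_neq0 j))) => // ; rewrite card_eq ltnn.
Qed.

End CoversOnce.

Lemma split_card (T : finType) (A : {set T}) (a b : nat) : (#|A| <= a + b)%N ->
  exists2 S : {set T}, S \subset A & (#|S| <= a)%N && (#|A :\: S| <= b)%N.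
Proof.
move=> Aab; have sub : [set x in take a (enum A)] \subset A.
  by apply/fintype.subsetP => x; rewrite inE => /mem_take; rewrite mem_enum.
have cardS : #|[set x in take a (enum A)]| = minn a #|A|.
  rewrite cardsE; move/card_uniqP: (take_uniq a (enum_uniq A)) => ->.
  by rewrite size_take_min -cardE.
exists [set x in take a (enum A)] => //.
by rewrite cardsDS // cardS geq_minl /=; lia.
Qed.

Lemma covers_once_rank (F : fieldType) (n k d r : nat)
    (u : 'I_r -> 'I_k -> {set 'I_n} -> F) :
  (3 <= k)%N -> (n + 2 <= 3 * d)%N ->
  (forall f : {ffun 'I_k -> {set 'I_n}},
     (covers_once f)%:R = \sum_i \prod_j u i j (f j)) ->
  (k * #|[set Y : {set 'I_n} | d <= #|Y|]| <= r)%N.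
Proof.
move=> k3 nd uE; set B := [set Y : {set 'I_n} | _].
have evalE (a : 'I_k -> {set 'I_n} -> F) :
    \sum_f (covers_once f)%:R * \prod_j a j (f j) =
    \sum_i \prod_j \sum_Y u i j Y * a j Y.
  under eq_bigr => f _ do rewrite uE mulr_suml.
  rewrite exchange_big; apply: eq_bigr => i _ /=.
  rewrite (bigA_distr_bigA (fun j Y => u i j Y * a j Y)).
  by apply: eq_bigr => f _; rewrite -big_split.
(* [S] indexes the terms that remain after [m] modes; each other term is killed,
   in one of these modes, by the elements [a j], prescribed below degree [d]. *)
suff: forall m, (m <= k)%N -> exists S : {set 'I_r}, (#|S| + m * #|B| <= r)%N /\
    forall s : 'I_k -> {set 'I_n}, (forall j, (#|s j| < d)%N) ->
    exists2 a : 'I_k -> {set 'I_n} -> F,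
      forall j (Y : {set 'I_n}), (#|Y| < d)%N -> a j Y = (Y == s j)%:R &
      forall i, i \notin S -> exists2 j : 'I_k, (j < m)%N &
        \sum_Y u i j Y * a j Y = 0.
  by case/(_ k (leqnn k)) => S [+ _]; apply: leq_trans; apply: leq_addl.
elim=> [_|m IH m_lt].
  exists [set: 'I_r]; rewrite cardsT card_ord mul0n addn0; split=> // s _.
  by exists (fun j Y => (Y == s j)%:R) => // i; rewrite inE.
have [S [Sr lift_S]] := IH (ltnW m_lt); pose mm := Ordinal m_lt.
have [v vB vS|J [JS JB lift_J]] := @substitution F _ _ (fun i => u i mm) S B.
  move=> Y; apply/eqP; apply: contraT => vY.
  case: (@arg_minnP _ Y (fun Z => v Z != 0) (fun Z => #|Z|)) => // V vV Vmin.
  have dV : (d <= #|V|)%N.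
    by apply: contraNT vV => dV; rewrite vB // inE.
  (* The bound n + 2 <= 3 d amounts to n - d <= 2 (d - 1), so the complement of [V] splits into two
     sets of fewer than [d] elements. *)
  have : (#|~: V| <= d.-1 + d.-1)%N by have := cardsC V; rewrite card_ord; lia.
  case/split_card => P PV /andP[Pd Qd].
  have [p [q]] : exists p q, [/\ p \in [set~ mm], q \in [set~ mm] & p != q].
    by apply/card_gt1P; rewrite cardsC1 card_ord; lia.
  rewrite !inE => -[pm qm pq].
  pose s0 j := if j == p then P else if j == q then ~: V :\: P else finset.set0.
  have s0d j : (#|s0 j| < d)%N.
    by rewrite /s0; case: ifP => _; [|case: ifP => _]; rewrite ?cards0; lia.
  have [a aE aS] := lift_S s0 s0d.
  pose a1 j := if j == mm then v else a j.
  pose s := [ffun j => if j == mm then V else s0 j].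
  have s_once : covers_once s.
    apply/forallP => x; rewrite (bigD1 mm) //= (bigD1 p) //= (bigD1 q) /=; last first.
      by rewrite qm eq_sym pq.
    rewrite big1 => [|j /andP[/andP[jm jp] jq]].
      rewrite !ffunE eqxx (negPf pm) (negPf qm) /s0 !eqxx [q == p]eq_sym (negPf pq) !inE.
      move/fintype.subsetP/(_ x): PV; rewrite !inE.
      by case: (x \in P); case: (x \in V) => //= /(_ isT).
    by rewrite ffunE (negPf jm) /s0 (negPf jp) (negPf jq) inE.
  (* Terms in [S] vanish in mode [mm] by [vS]; the others vanish in an earlier mode, where [a1]
     agrees with [a]. *)
  have : \sum_f (covers_once f)%:R * \prod_j a1 j (f j) = 0.
    rewrite evalE big1 // => i _; have [iS|/aS[j jm uj]] := boolP (i \in S).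
      by rewrite (bigD1 mm) //= /a1 eqxx vS ?mul0r.
    by rewrite (bigD1 j) //= /a1 (_ : (j == mm) = false) ?uj ?mul0r // -val_eqE ltn_eqF.
  rewrite (@covers_once_leading _ _ _ a1 s mm s_once) => [||j Z jm|Z].
  - by rewrite /a1 ffunE eqxx => v0; rewrite v0 eqxx in vV.
  - by move=> j jm; rewrite /a1 ffunE (negPf jm) aE // eqxx.
  - rewrite /a1 ffunE (negPf jm); case: (ltnP #|Z| d) => [Zd|dZ _]; last first.
      by right; apply: leq_trans dZ.
    by rewrite aE //; case: (Z =P s0 j) => [->|_]; [left|rewrite eqxx].
  - by rewrite /a1 ffunE eqxx => /Vmin.
(* The terms of [J] are killed in mode [mm] by changing [a mm] on [B] only, so its prescribed values
   below degree [d] survive. *)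
exists (S :\: J); split.
  by rewrite cardsDS // JB mulSn addnA subnK // -JB subset_leq_card.
move=> s sd; have [a aE aS] := lift_S s sd.
have [a' a'E a'J] := lift_J (a mm).
exists (fun j => if j == mm then a' else a j) => [j Y Yd|i].
  by case: eqP => [->|_]; rewrite ?a'E ?aE // inE -ltnNge.
rewrite inE negb_and negbK => /orP[iJ|/aS[j jm uj]].
  by exists mm; rewrite ?eqxx ?a'J.
exists j; first exact: ltnW.
by rewrite (_ : (j == mm) = false) // -val_eqE ltn_eqF.
Qed.

(** * Counting the small subsets of [n] *)

(** This is 2^n times the variance of a sum of n independent signs: n - 2 #|Y| is the sum of the
    [sg x Y], and distinct signs are orthogonal over all subsets. *)
Lemma sum_signs_sqr (n : nat) :
  \sum_(Y : {set 'I_n}) (n%:Z - (2 * #|Y|)%N%:Z) ^+ 2 = (n * 2 ^ n)%N%:Z.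
Proof.
pose sg (x : 'I_n) (Y : {set 'I_n}) : int := (-1) ^+ (x \in Y).
have sumE (Y : {set 'I_n}) : n%:Z - (2 * #|Y|)%N%:Z = \sum_x sg x Y.
  apply/esym; rewrite (bigID (mem Y)) /=.
  rewrite (eq_bigr (fun=> -1)) => [|x xY]; last by rewrite /sg xY.
  rewrite [X in _ + X](eq_bigr (fun=> 1)) => [|x xY]; last by rewrite /sg (negPf xY).
  rewrite !sumr_const.
  have -> : #|[pred x | x \notin Y]| = #|~: Y| by apply: eq_card => x; rewrite !inE.
  have := cardsC Y; rewrite card_ord mulNrn !pmulrn !intz.
  by move: #|Y| #|~: Y| => a b; lia.
have orth x y : \sum_Y sg x Y * sg y Y = if y == x then (2 ^ n)%N%:Z else 0.
  case: eqVneq => [->|yx].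
    rewrite (eq_bigr (fun=> 1)) => [|Y _]; last by rewrite -expr2 sqrr_sign.
    by rewrite sumr_const -cardsT -powersetT card_powerset cardsT card_ord natz.
  (* Toggling x in Y flips the sign of the summand. *)
  pose h (Y : {set 'I_n}) := if x \in Y then Y :\ x else x |: Y.
  have hx Y : (x \in h Y) = (x \notin Y).
    by rewrite /h; case: ifP => xY; rewrite !inE eqxx.
  have hy Y : (y \in h Y) = (y \in Y).
    by rewrite /h; case: ifP => xY; rewrite !inE (negPf yx).
  have hK : involutive h.
    move=> Y; rewrite {1}/h hx /h; case: (boolP (x \in Y)) => xY /=.
      by rewrite finset.setD1K.
    by rewrite finset.setU1K.
  suff : \sum_Y sg x Y * sg y Y = - \sum_Y sg x Y * sg y Y by lia.
  rewrite {1}(reindex_inj (inv_inj hK)) -sumrN; apply: eq_bigr => Y _.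
  by rewrite /sg hx hy signrN mulNr.
under eq_bigr => Y _ do rewrite sumE expr2 mulr_suml.
rewrite exchange_big /=.
under eq_bigr => x _.
  under eq_bigr => Y _ do rewrite mulr_sumr.
  rewrite exchange_big /=; under eq_bigr => y _ do rewrite orth.
  rewrite -big_mkcond big_pred1_eq.
  over.
by rewrite sumr_const card_ord -mulr_natl natz -PoszM.
Qed.

(* Chebyshev's inequality: |Y| < d forces n <= 6 (n - 2|Y|), except for n < 4. *)
Lemma card_small_sets (n d : nat) : (3 * d <= n + 4)%N ->
  (n * #|[set Y : {set 'I_n} | #|Y| < d]| <= 36 * 2 ^ n)%N.
Proof.
move=> dn; set B := [set Y : {set 'I_n} | _].
have [n4|n4] := ltnP n 4.
  apply: leq_mul; first by lia.
  by rewrite -[X in (_ <= 2 ^ X)%N](card_ord n) -cardsT -card_powerset powersetT cardsT max_card.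
(* The second moment bounds n^2 #|B|; the common factor n is cancelled at the end. *)
have : (n * (n * #|B|) <= n * (36 * 2 ^ n))%N.
  rewrite -lez_nat [X in _ <= X](_ : _ = 36 * (n * 2 ^ n)%N%:Z); last by lia.
  rewrite -sum_signs_sqr mulr_sumr (bigID (mem B)) /=.
  apply: le_trans (_ : \sum_(Y in B) (n * n)%N%:Z <= _).
    by rewrite sumr_const -mulr_natl natz -PoszM lez_nat mulnA mulnC.
  rewrite -[leLHS]addr0; apply: lerD; last first.
    by apply: sumr_ge0 => Y _; rewrite mulr_ge0 ?sqr_ge0.
  apply: ler_sum => Y; rewrite inE => Yd.
  have : n%:Z <= 6 * (n%:Z - (2 * #|Y|)%N%:Z) by move: #|Y| Yd => y yd; lia.
  by move: (_ - _) => z nz; rewrite expr2 PoszM; nia.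
by rewrite leq_pmul2l //; lia.
Qed.

Lemma W_pow_rank (R : realType) (k n d : nat) :
  (3 <= k)%N -> (1 <= n)%N -> (n + 2 <= 3 * d)%N ->
  (k * #|[set Y : {set 'I_n} | d <= #|Y|]| <= tensor_rank (kron_pow (W R k) n))%N.
Proof.
move=> k3 n1 nd; have [b [c bK cK] tb] := @W_pow_sets R k n n1.
have [+ _] := tensor_rankP (ltnW (ltnW k3)) (kron_pow (W R k) n).
move: (tensor_rank _) => q [v tv].
apply: (@covers_once_rank _ _ _ _ _ (fun i j Y => v i j ord0 (c Y)) k3 nd) => f.
have := tb [ffun j => c (f j)]; rewrite (_ : [ffun j => b _] = f) => [<-|]; last first.
  by apply/ffunP => j; rewrite !ffunE cK.
rewrite tv sum_ffunE; apply: eq_bigr => i _; rewrite /simple_tensor ffunE.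
by apply: eq_bigr => j _; rewrite ffunE.
Qed.

(** * Border rank *)

(** A kernel row of l1-norm [S] has all entries at most e S in modulus, so S <= m e S and S = 0.
    This explicit form of the openness of invertibility applies to a single member of the
    sequence. *)
Lemma row_free_near_injection (F : numFieldType) (m : nat) (M : 'M[F]_m)
    (s : 'I_m -> 'I_m) (e : F) : injective s ->
  (forall i j, `|M i j - (j == s i)%:R| <= e) -> m%:R * e < 1 -> row_free M.
Proof.
move=> s_inj Me me; rewrite -kermx_eq0; apply/eqP/row_matrixP => p; rewrite row0.
have wM : row p (kermx M) *m M = 0 by rewrite -row_mul mulmx_ker row0.
move: (row p _) wM => w wM; pose S := \sum_i `|w ord0 i|.
have wS i : `|w ord0 i| <= e * S.
  have -> : w ord0 i = - \sum_l w ord0 l * (M l (s i) - (s i == s l)%:R).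
    under eq_bigr => l _ do rewrite mulrBr.
    rewrite sumrB; have := congr1 (fun A : 'rV_ _ => A ord0 (s i)) wM.
    rewrite [LHS]mxE [RHS]mxE => ->; rewrite sub0r opprK (bigD1 i) //= eqxx mulr1.
    rewrite big1 ?addr0 // => l li; rewrite (_ : (_ == _) = false) ?mulr0 //.
    by rewrite (inj_eq s_inj) eq_sym (negPf li).
  rewrite normrN mulr_sumr; apply: le_trans (ler_norm_sum _ _ _) _.
  by apply: ler_sum => l _; rewrite normrM mulrC ler_wpM2r.
have S0 : S = 0.
  have S_ge0 : 0 <= S by apply: sumr_ge0.
  have : S <= m%:R * e * S.
    rewrite -mulrA {1}/S; apply: le_trans (ler_sum _ (fun i _ => wS i)) _.
    by rewrite sumr_const card_ord mulr_natl.
  rewrite -subr_ge0 -{2}[S]mul1r -mulrBl; move: S_ge0; rewrite le_eqVlt => /orP[/eqP //|S_gt0].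
  by rewrite pmulr_lge0 // subr_ge0 => /(lt_le_trans me); rewrite ltxx.
apply/rowP => i; rewrite [RHS]mxE; apply/eqP; rewrite -normr_le0.
by apply: le_trans (wS i) _; rewrite S0 mulr0.
Qed.

Lemma normc_le_tensor_dist (R : realType) (k d : nat) (s t : tensor R k d) f :
  ComplexField.Normc.normc (s f - t f) <= tensor_dist s t.
Proof.
have n0 (z : R[i]) : 0 <= ComplexField.Normc.normc z by case: z => x y; apply: sqrtr_ge0.
rewrite -[leLHS]ger0_norm // -sqrtr_sqr ler_sqrt; last by apply: sumr_ge0 => g _; exact: sqr_ge0.
by rewrite (bigD1 f) //= lerDl; apply: sumr_ge0 => g _; exact: sqr_ge0.
Qed.

Lemma W_pow_border_ge (R : realType) (k n r : nat) : (2 <= k)%N -> (1 <= n)%N ->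
  limit_of_rank_le (kron_pow (W R k) n) r -> (2 ^ n <= r)%N.
Proof.
move=> k2 n1 [u [ur ut]]; have [b [c bK cK] tb] := @W_pow_sets R k n n1.
set t := kron_pow _ _ in ut tb.
(* With this radius, the matrix size 2^n times the entrywise error is less than 1. *)
have [m um] : exists m, tensor_dist (u m) t < (2 ^ n)%:R^-1.
  have N0 : 0 < (2 ^ n)%:R^-1 :> R by rewrite invr_gt0 ltr0n expn_gt0.
  move/cvgrPdist_lt: ut => /(_ _ N0)[m _ /(_ m (leqnn m))] /=.
  by rewrite sub0r normrN => h; exists m; apply: le_lt_trans h; exact: ler_norm.
apply: leq_trans (ur m); have [+ _] := tensor_rankP (ltnW k2) (u m).
move: (tensor_rank _) => q [v uv].
pose j0 := Ordinal (ltnW k2); pose j1 := Ordinal k2; pose z := c finset.set0.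
pose g i i' : {ffun 'I_k -> _} := [ffun j => if j == j0 then i else if j == j1 then i' else z].
pose M := \matrix_(i, i') u m (g i i').
have <- : \rank M = (2 ^ n)%N.
  apply/eqP; apply: (@row_free_near_injection _ _ M (fun i => c (~: b i))
    (tensor_dist (u m) t)%:C%C).
  - by move=> i j /(can_inj cK)/finset.setC_inj/(can_inj bK).
  - move=> i j; rewrite mxE.
    have -> : (j == c (~: b i))%:R = t (g i j).
      rewrite tb; congr (nat_of_bool _)%:R; rewrite -(can_eq bK) cK.
      have g_sum x : (\sum_l (x \in [ffun l => b (g i j l)] l) = (x \in b i) + (x \in b j))%N.
        rewrite (bigD1 j0) //= (bigD1 j1) //= big1 => [|l /andP[/negPf l0 /negPf l1]].
          by rewrite !ffunE /= addn0.
        by rewrite !ffunE l0 l1 cK inE.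
      apply/eqP/forallP => [bj x|b_once]; first by rewrite g_sum bj inE; case: (x \in b i).
      apply/setP => x; move: (b_once x); rewrite g_sum inE.
      by case: (x \in b i); case: (x \in b j).
    have := normc_le_tensor_dist (u m) t (g i j); rewrite -lecR; apply: le_trans.
    by case: (_ - _) => x y; rewrite normc_def.
  - rewrite -[1]/(real_complex R 1) -(rmorph_nat (real_complex R)) -rmorphM ltcR.
    by rewrite -ltr_pdivlMl ?mulr1 // ltr0n expn_gt0.
(* Splitting off mode [j0] factors the flattening through dimension [q]. *)
pose A := \matrix_(i < 2 ^ n, l < q) v l j0 ord0 i.
pose B := \matrix_(l < q, i' < 2 ^ n)
  \prod_(j < k | j != j0) v l j ord0 (if j == j1 then i' else z).
have -> : M = A *m B.
  apply/matrixP => i i'; rewrite !mxE uv sum_ffunE; apply: eq_bigr => l _.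
  rewrite /simple_tensor ffunE (bigD1 j0) //= !mxE ffunE eqxx; congr (_ * _).
  by apply: eq_bigr => j /negPf jj; rewrite ffunE jj.
exact: leq_trans (mxrankM_maxl _ _) (rank_leq_col _).
Qed.

(* e^-1 * (e ^ p - 0 ^ p) is the entry of ((e_0 + e e_1)^{(x) k} - e_0^{(x) k}) / e
   at a tuple of [p] ones and [k - p] zeros; note 0 ^ 0 = 1. *)
Lemma prod_sub_le (R : realFieldType) (I : finType) (p : I -> nat) (e : R) :
  0 < e <= 1 ->
  `|\prod_x (e^-1 * (e ^+ p x - 0 ^+ p x)) - [forall x, p x == 1]%N%:R| <= e.
Proof.
move=> /andP[e0 e1]; pose w (q : nat) : R := e^-1 * (e ^+ q - 0 ^+ q).
have wE q : w q = if q is q'.+1 then e ^+ q' else 0.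
  case: q => [|q]; first by rewrite /w !expr0 subrr mulr0.
  by rewrite /w expr0n subr0 exprS mulKf ?gt_eqF.
have w_ge0 q : 0 <= w q by rewrite wE; case: q => // q; rewrite exprn_ge0 // ltW.
have w_le1 q : w q <= 1 by rewrite wE; case: q => // q; rewrite exprn_ile1 // ltW.
have [/forallP p1|/forallPn[x px]] := boolP [forall x, p x == 1%N].
  rewrite big1 ?subrr ?normr0 1?ltW // => x _.
  by rewrite -/(w (p x)) (eqP (p1 x)) wE.
rewrite subr0 ger0_norm; last by apply: prodr_ge0 => y _; exact: w_ge0.
rewrite (bigD1 x) //= -[leRHS]mulr1; apply: ler_pM; first exact: w_ge0.
- by apply: prodr_ge0 => y _; exact: w_ge0.
- rewrite -/(w _) wE; case: (p x) px => [|[|q]] //= _; first exact: ltW.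
  by rewrite exprS ler_piMr ?exprn_ile1 // ltW.
- by apply: prodr_ile1 => y _; rewrite w_ge0 w_le1.
Qed.

Lemma W_pow_border_le (R : realType) (k n : nat) : (1 <= k)%N -> (1 <= n)%N ->
  limit_of_rank_le (kron_pow (W R k) n) (2 ^ n).
Proof.
move=> k1 n1; have [b _ tb] := @W_pow_sets R k n n1.
pose p (f : {ffun 'I_k -> 'I_(2 ^ n)}) (x : 'I_n) : nat := (\sum_j (x \in b (f j)))%N.
pose coord (e : R) f : R := \prod_x (e^-1 * (e ^+ p f x - 0 ^+ p f x)).
pose u e : tensor R k (2 ^ n) := [ffun f => (coord e f)%:C%C].
exists (fun m => u m.+1%:R^-1); split=> [m|].
  apply: (tensor_rankP k1 _).2.
  set e : R := m.+1%:R^-1.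
  rewrite [X in sum_of_simple _ X](_ : _ = #|{ffun 'I_n -> bool}|); last first.
    by rewrite card_ffun card_bool card_ord.
  (* Each factor is a difference of two powers; [h] picks one of them for every [x], and expanding
     the product gives 2^n simple tensors, whose scalars are put into the first mode. *)
  pose y (s : bool) : R := if s then e^-1 else - e^-1.
  pose z (s : bool) : R := if s then e else 0.
  pose v (h : {ffun 'I_n -> bool}) (j : 'I_k) : 'rV[R[i]]_(2 ^ n) := \row_i
    ((if j == Ordinal k1 then \prod_x y (h x) else 1) * \prod_x z (h x) ^+ (x \in b i))%:C%C.
  exists (fun i => v (enum_val i)).
  rewrite -(@big_enum_val _ _ _ _ predT (fun h => simple_tensor (v h))).
  apply/ffunP => f; rewrite ffunE sum_ffunE /coord.
  under eq_bigr => x _.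
    rewrite (_ : _ * _ = \sum_s y s * z s ^+ p f x); last first.
      by rewrite big_bool /= mulrBr mulNr.
    over.
  rewrite bigA_distr_bigA rmorph_sum; apply: eq_bigr => h _.
  rewrite /simple_tensor ffunE /=.
  under [RHS]eq_bigr => j _ do rewrite mxE.
  rewrite -rmorph_prod; congr (_%:C)%C; rewrite !big_split /=; congr (_ * _).
    by rewrite [RHS](bigD1 (Ordinal k1)) //= [X in _ = _ * X]big1 ?mulr1 // => j /negPf ->.
  rewrite exchange_big; apply: eq_bigr => x _ /=; rewrite /p.
  by rewrite expr_sum.
pose N : R := #|{ffun 'I_k -> 'I_(2 ^ n)}|%:R.
have dist_le (e : R) : 0 < e <= 1 -> tensor_dist (u e) (kron_pow (W R k) n) <= Num.sqrt N * e.
  move=> e01; have /andP[e0 _] := e01.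
  rewrite -[e in leRHS]ger0_norm ?(ltW e0) // -sqrtr_sqr -sqrtrM ?ler0n //.
  apply: ler_wsqrtr; rewrite /N [leRHS]mulr_natl -sumr_const; apply: ler_sum => f _.
  rewrite ler_sqr ?nnegrE; last exact: ltW.
    rewrite /u ffunE tb (_ : covers_once _ = [forall x, p f x == 1%N]); last first.
      by apply/eq_forallb => x; congr (_ == _); apply: eq_bigr => j _; rewrite ffunE.
    rewrite -(rmorph_nat (real_complex R)) -rmorphB /= expr0n addr0 sqrtr_sqr.
    exact: prod_sub_le.
  by case: (_ - _) => x y; apply: sqrtr_ge0.
apply: (@squeeze_cvgr _ _ _ _ (fun=> 0) (fun m => Num.sqrt N * m.+1%:R^-1)).
- apply: nearW => m; rewrite sqrtr_ge0 dist_le //.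
  by rewrite invr_gt0 ltr0n /= invf_le1 ?ler1n ?ltr0n.
- exact: cvg_cst.
rewrite -[X in (_ --> X)%classic](mulr0 (Num.sqrt N)); apply: cvgMr; exact: cvg_harmonic.
Qed.

(** * Asymptotics *)

Lemma W_pow_rank_asymptotic (R : realType) (k n : nat) :
  (3 <= k)%N -> (1 <= n)%N ->
  k%:R * 2 ^+ n - k%:R * 36 * 2 ^+ n / n%:R <=
    (tensor_rank (kron_pow (W R k) n))%:R :> R.
Proof.
(* The largest [d] with 3 d <= n + 4 also has n + 2 <= 3 d, so the rank bound and the counting bound
   both apply. *)
move=> k3 n1; pose d := ((n + 4) %/ 3)%N.
have nd : (n + 2 <= 3 * d)%N by rewrite /d; lia.
have dn : (3 * d <= n + 4)%N by rewrite /d; lia.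
apply: le_trans (_ : (k * #|[set Y : {set 'I_n} | (d <= #|Y|)%N]|)%N%:R <= _); last first.
  by rewrite ler_nat W_pow_rank.
have := card_small_sets dn; set B := [set Y : {set 'I_n} | _].
have <- : ~: B = [set Y : {set 'I_n} | (d <= #|Y|)%N].
  by apply/setP => Y; rewrite !inE -leqNgt.
have cardB : (#|B| + #|~: B| = 2 ^ n)%N.
  by rewrite cardsC -cardsT -powersetT card_powerset cardsT card_ord.
rewrite -(ler_nat R) natrM [leRHS]natrM mulrC => small.
rewrite natrM -!mulrA -mulrBr ler_wpM2l // lerBlDr -natrX -{1}cardB natrD addrC lerD2l.
by rewrite mulrA ler_pdivlMr ?ltr0n.
Qed.

Local Open Scope classical_set_scope.

Lemma inv_nat_littleo (R : realType) (c : R) (g : nat -> R) :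
  (fun n => c * g n / n%:R) =o_\oo g.
Proof.
apply/eqoP => eps eps0; near=> n.
have n0 : 0 < n%:R :> R by near: n; exact: nbhs_infty_gtr.
rewrite mulrAC normrM ler_wpM2r // normrM normfV (gtr0_norm n0) ler_pdivrMr //.
rewrite mulrC -ler_pdivrMr //; near: n.
by apply: filterS (nbhs_infty_gtr (`|c| / eps)) => n; exact: ltW.
Unshelve. all: by end_near. Qed.

Theorem theorem2 (R : realType) (k : nat) (k_ge3 : (3 <= k)%N) :
  exists t : forall n : nat, tensor R k (2 ^ n),
    [/\ forall n : nat, (1 <= n)%N -> t n = kron_pow (W R k) n,
        exists2 e : nat -> R, e =o_\oo (fun _ : nat => 1 : R) &
          forall n : nat, (1 <= n)%N ->
            k%:R - e n <= (tensor_rank (t n))%:R / (border_rank (t n))%:R :> R,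
        forall n : nat, (1 <= n)%N -> border_rank (t n) = (2 ^ n)%N
      & exists2 e : nat -> R, e =o_\oo (fun n : nat => 2 ^+ n : R) &
          forall n : nat, (1 <= n)%N ->
            k%:R * 2 ^+ n - e n <= (tensor_rank (t n))%:R :> R].
Proof.
pose c : R := k%:R * 36.
have border n : (1 <= n)%N -> border_rank (kron_pow (W R k) n) = (2 ^ n)%N.
  move=> n1; have [h hmin] := border_rankP (kron_pow (W R k) n).
  apply/eqP; rewrite eqn_leq (W_pow_border_ge (ltnW k_ge3) n1 h) andbT.
  by apply/hmin/W_pow_border_le => //; apply: leq_trans k_ge3.
exists (fun n => kron_pow (W R k) n); split=> //.
  (* Division by the border rank 2^n turns the error c 2^n / n into c / n. *)
  exists (fun n => c * 1 / n%:R); first exact: inv_nat_littleo.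
  move=> n n1; rewrite border // ler_pdivlMr ?ltr0n ?expn_gt0 //.
  apply: le_trans (W_pow_rank_asymptotic R k_ge3 n1).
  by rewrite natrX mulrBl mulr1 mulrAC.
exists (fun n => c * 2 ^+ n / n%:R); first exact: inv_nat_littleo.
by move=> n; apply: W_pow_rank_asymptotic.
Qed.
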